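(* Every finite Eulerian binomial poset $P$ of even rank $n=2m\geq 4$ is isomorphic either to the butterfly poset $T_n$ or to the boolean lattice $B_n$.
   Context: A finite graded poset with minimum $\hat 0$ and maximum $\hat 1$ is Eulerian if every interval $[x,y]$ with $x<y$ has as many elements of even rank as of odd rank. A finite binomial poset is a finite poset with $\hat 0$ and $\hat 1$ in which every interval is graded and any two intervals $[x,y]$ of the same length $n=\rho(y)-\rho(x)$ have the same number $B(n)$ of maximal chains. The boolean lattice $B_n$ is the poset of subsets of $\{1,\dots,n\}$ ordered by inclusion. The butterfly poset $T_n$ of rank $n$ consists of $\hat 0$, $\hat 1$ and the elements $(k,i)$ with $1\le k\le n-1$, $i\in\{1,2\}$, ordered by $\hat 0<(k,i)<\hat 1$ and $(k,i)\prec (k+1,j)$ (cover relation) for all $i,j\in\{1,2\}$. *)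

(* Defs.v *)
From HB Require Import structures.
From mathcomp Require Import all_boot all_order.

Set Implicit Arguments.
Unset Strict Implicit.
Unset Printing Implicit Defensive.

Import Order.Theory.
Import preorder.Order.SetSubsetOrder.Exports Order.SetSubsetOrder.Exports.

Section FinitePosets.
Variables (d : Order.disp_t) (P : finPOrderType d).
Implicit Types (x y z : P) (C : {set P}).
Local Open Scope order_scope.

Definition segment x y : {set P} := [set z | x <= z <= y].

Definition chain_of x y C : bool :=
  (C \subset segment x y) && [forall a in C, forall b in C, a >=< b].

Definition max_chains x y : {set {set P}} := [set C | maxset (chain_of x y) C].

(* The length of a chain is its number of elements minus one. *)
Definition segment_length x y : nat :=
  (\max_(C in max_chains x y) #|C|.-1)%N.

Definition graded_segment x y : Prop :=
  {in max_chains x y &, forall C D : {set P}, #|C| = #|D|}.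

End FinitePosets.

Section BoundedPosets.
Variables (d : Order.disp_t) (P : finTBPOrderType d).
Implicit Types x y z u v : P.
Local Open Scope order_scope.

Definition rho x : nat := segment_length \bot x.

Definition graded : Prop := @graded_segment d P \bot \top.

Definition poset_rank : nat := rho \top.

Definition eulerian : Prop :=
  graded /\
  forall x y, x < y ->
    #|[set z in segment x y | ~~ odd (rho z)]|
    = #|[set z in segment x y | odd (rho z)]|.

Definition binomial_poset : Prop :=
  (forall x y, x <= y -> graded_segment x y) /\
  (forall x y u v, x <= y -> u <= v ->
     (rho y - rho x = rho v - rho u)%N ->
     #|max_chains x y| = #|max_chains u v|).

End BoundedPosets.

Arguments graded {d} P.
Arguments poset_rank {d} P.
Arguments eulerian {d} P.
Arguments binomial_poset {d} P.

Definition poset_isomorphic (d d' : Order.disp_t)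
    (P : porderType d) (Q : porderType d') : Prop :=
  exists2 f : P -> Q, bijective f & {mono f : x y / (x <= y)%O}.

Definition boolean_lattice (n : nat) : porderType _ := {subset 'I_n}.

Lemma boolean_lattice_leE (n : nat) (A B : {set 'I_n}) :
  ((A : boolean_lattice n) <= (B : boolean_lattice n))%O = (A \subset B).
Proof. by []. Qed.

(* [BMid k i] is the element (k + 1, i + 1) of the butterfly poset. *)
Inductive butterfly (n : nat) : Type :=
  | BBot
  | BMid of 'I_n.-1 & 'I_2
  | BTop.

Arguments BBot {n}.
Arguments BMid {n}.
Arguments BTop {n}.

Section Butterfly.
Variable n : nat.
Implicit Types x y : butterfly n.

Definition butterfly_enc x : option (option ('I_n.-1 * 'I_2)) :=
  match x with
  | BBot => None
  | BMid k i => Some (Some (k, i))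
  | BTop => Some None
  end.

Definition butterfly_dec (u : option (option ('I_n.-1 * 'I_2))) : butterfly n :=
  match u with
  | None => BBot
  | Some (Some (k, i)) => BMid k i
  | Some None => BTop
  end.

Lemma butterfly_encK : cancel butterfly_enc butterfly_dec.
Proof. by case. Qed.

HB.instance Definition _ := Finite.copy (butterfly n) (can_type butterfly_encK).

(* The relations generating the order; 0 < 1 only matters when there is no
   intermediate element. *)
Definition butterfly_step : rel (butterfly n) := fun x y =>
  match x, y with
  | BBot, BMid _ _ | BMid _ _, BTop | BBot, BTop => true
  | BMid k _, BMid l _ => l == k.+1 :> nat
  | _, _ => false
  end.

Definition butterfly_le : rel (butterfly n) := connect butterfly_step.

Definition butterfly_level x : nat :=
  match x with
  | BBot => 0
  | BMid k _ => k.+1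
  | BTop => n.-1.+1
  end.

Lemma butterfly_step_level x y :
  butterfly_step x y -> butterfly_level x < butterfly_level y.
Proof.
by case: x y => [|k i|] [|l j|] //=; rewrite ?ltnS // => /eqP->.
Qed.

Lemma butterfly_leE x y :
  butterfly_le x y = (x == y) || (butterfly_level x < butterfly_level y).
Proof.
apply/idP/orP => [/connectP[p xp ->]|[/eqP->|]]; last 2 first.
- exact: connect0.
- case: x y => [|k i|] [|l j|] //=; try by move=> _; apply: connect1.
  + rewrite ltnS => kl; have [e le_e] := ubnP (l - k).
    elim: e => // e IHe in k i kl le_e *.
    have [kl1|kl1] := eqVneq (l : nat) k.+1; first by apply: connect1; apply/eqP.
    have lt1 : k.+1 < l by rewrite ltn_neqAle eq_sym kl1.
    have k1 : k.+1 < n.-1 by apply: ltn_trans lt1 (ltn_ord l).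
    apply: connect_trans (IHe (Ordinal k1) ord0 lt1 _).
      by apply: connect1 => /=.
    rewrite /= subnS prednK ?subn_gt0 //; exact: le_e.
  + by rewrite ltnS ltnNge (ltnW (ltn_ord l)).
  + by rewrite ltnn.
elim: p x xp => [|z p IHp] x /=; first by left.
case/andP=> /butterfly_step_level xz /IHp[/eqP<-|zy]; right=> //.
exact: ltn_trans xz zy.
Qed.

Lemma butterfly_le_refl : reflexive butterfly_le.
Proof. by move=> x; apply: connect0. Qed.

Lemma butterfly_le_anti : antisymmetric butterfly_le.
Proof.
move=> x y; rewrite !butterfly_leE => /andP[/orP[/eqP->//|xy] /orP[/eqP->//|yx]].
by have := ltn_trans xy yx; rewrite ltnn.
Qed.

Lemma butterfly_le_trans : transitive butterfly_le.
Proof. by move=> y x z; apply: connect_trans. Qed.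

Fact butterfly_display : Order.disp_t. Proof. exact: Order.Disp tt tt. Qed.

HB.instance Definition _ := Order.Le_isPOrder.Build butterfly_display
  (butterfly n) butterfly_le_refl butterfly_le_anti butterfly_le_trans.

End Butterfly.

(* Main.v *)
(** Let [B l] be the number of maximal chains of an interval of length [l] and
    [A l = B l / B (l - 1)] its number of atoms.  An interval of length [L] has
    [B L / (B k * B (L - k))] elements of relative rank [k], so the Eulerian
    condition reads [sum_k (-1)^k / (B k * B (L - k)) = 0].  For even [L] this
    determines a relation between [A (L - 1)] and [A L] from the smaller
    values.  At [L = 4] it leaves [(A 3, A 4) = (2, 2)] or [(3, 4)].  From
    [(2, 2)] on, the relation always leaves the same two options, of which
    [(3, 4)] is excluded for [L >= 6] by looking at ranks 2 and 3; from
    [(3, 4)] on, monotonicity of [A] forces [A k = k].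

    If [A k = 2] for all [k >= 2], each inner rank has two elements and each
    element lies below both elements of the next rank.  If [A k = k], two
    covers of an element have exactly one common cover inside any interval that
    contains them, so sending an element to the set of atoms below it is an
    order embedding into the subsets of the [n] atoms, and [P] has [2 ^ n]
    elements. *)
Require Import Defs.
From mathcomp Require Import all_boot all_order all_algebra.
From mathcomp Require Import zify ring lra.

Set Implicit Arguments.
Unset Strict Implicit.
Unset Printing Implicit Defensive.

Import Order.Theory.

(** * Cutting and gluing maximal chains *)

Section MaximalChains.
Variables (d : Order.disp_t) (P : finPOrderType d).
Implicit Types (x y z : P) (C D : {set P}).
Local Open Scope order_scope.

(** Turns maximality among sets into saturation under single elements, the form in which cutting and
    gluing are checked. *)
Lemma max_chainP x y C :
  reflect [/\ {in C, forall a, x <= a <= y}, {in C &, forall a b, a >=< b}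
            & forall z, x <= z <= y -> {in C, forall a, a >=< z} -> z \in C]
          (C \in max_chains x y).
Proof.
have chainP D : reflect ({in D, forall a, x <= a <= y} /\
    {in D &, forall a b, a >=< b}) (chain_of x y D).
  apply: (iffP andP) => [[/subsetP sD cD]|[sD cD]]; split.
  - by move=> a /sD; rewrite inE.
  - by move=> a b aD bD; move/forall_inP/(_ a aD)/forall_inP/(_ b bD): cD.
  - by apply/subsetP=> a /sD; rewrite inE.
  - by apply/forall_inP=> a aD; apply/forall_inP=> b bD; apply: cD.
rewrite inE; apply: (iffP maxsetP) => [[/chainP[sC cC] mC]|[sC cC mC]].
- split=> // z xzy zC; rewrite -(mC (z |: C)) ?setU11 ?subsetUr //.
  apply/chainP; split=> [a /setU1P[->|/sC]|a b /setU1P[->|aC] /setU1P[->|bC]] //.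
  + exact: comparablexx.
  + by rewrite comparable_sym zC.
  + exact: zC.
  + exact: cC.
- split=> [|D /chainP[sD cD] CD]; first exact/chainP.
  apply/eqP; rewrite eqEsubset CD andbT; apply/subsetP=> z zD.
  by apply: mC => [|a /(subsetP CD) aD]; [apply: sD | apply: cD].
Qed.

Lemma max_chain_endpoints x y C :
  x <= y -> C \in max_chains x y -> x \in C /\ y \in C.
Proof.
move=> xy /max_chainP[sC _ mC]; split; apply: mC; rewrite ?lexx ?xy // => a /sC.
  by case/andP=> xa _; rewrite comparable_sym; apply: le_comparable.
by case/andP=> _ ay; apply: le_comparable.
Qed.

Lemma max_chain_exists x y : exists C, C \in max_chains x y.
Proof.
have [|C mC _] := @maxset_exists _ (chain_of x y) set0; last by exists C; rewrite inE.
by apply/andP; split; [exact: sub0set | apply/forall_inP=> a; rewrite inE].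
Qed.

Lemma max_chain_glue x z y C D : x <= z -> z <= y ->
  C \in max_chains x z -> D \in max_chains z y -> C :|: D \in max_chains x y.
Proof.
move=> xz zy mC mD; have [_ zC] := max_chain_endpoints xz mC.
have /max_chainP[sC cC satC] := mC; have /max_chainP[sD cD satD] := mD.
have CD a b : a \in C -> b \in D -> a <= b.
  by move=> /sC/andP[_ az] /sD/andP[zb _]; apply: le_trans zb.
apply/max_chainP; split=> [a /setUP[/sC|/sD]|a b|w /andP[xw wy] cw].
- by case/andP=> -> /le_trans->.
- by case/andP=> za ->; rewrite (le_trans xz za).
- case/setUP=> aC /setUP[bC|bC]; [exact: cC | | | exact: cD].
    exact/le_comparable/CD.
  exact/ge_comparable/CD.
(* Being comparable to the gluing point [z], the element [w] lies on one side of it, and the chain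
   on that side is saturated. *)
- have /orP[zw|wz] : z >=< w by apply: cw; rewrite inE zC.
    by rewrite inE satD ?orbT ?zw // => a aD; apply: cw; rewrite inE aD orbT.
  by rewrite inE satC ?xw // => a aC; apply: cw; rewrite inE aC.
Qed.

(** The part of [C] beyond [z] lies above all of [segment x z], so the saturation of [C] passes to
    its lower part. *)
Lemma max_chain_lower x z y C : z \in C ->
  C \in max_chains x y -> C :&: segment x z \in max_chains x z.
Proof.
move=> zC /max_chainP[sC cC satC].
have /andP[xz zy] := sC z zC.
apply/max_chainP; split=> [a|a b|w /andP[xw wz] cw].
- by rewrite !inE => /andP[].
- by move=> /setIP[aC _] /setIP[bC _]; apply: cC.
- rewrite !inE xw wz !andbT; apply: satC => [|a aC].
    by rewrite xw (le_trans wz zy).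
  have /orP[az|za] := cC a z aC zC.
    by apply: cw; rewrite !inE aC az; case/andP: (sC a aC) => ->.
  by rewrite comparable_sym; apply/le_comparable/(le_trans wz).
Qed.

Lemma max_chain_upper x z y C : z \in C ->
  C \in max_chains x y -> C :&: segment z y \in max_chains z y.
Proof.
move=> zC /max_chainP[sC cC satC].
have /andP[xz zy] := sC z zC.
apply/max_chainP; split=> [a|a b|w /andP[zw wy] cw].
- by rewrite !inE => /andP[].
- by move=> /setIP[aC _] /setIP[bC _]; apply: cC.
- rewrite !inE zw wy !andbT; apply: satC => [|a aC].
    by rewrite wy (le_trans xz zw).
  have /orP[az|za] := cC a z aC zC.
    exact/le_comparable/(le_trans az).
  by apply: cw; rewrite !inE aC za; case/andP: (sC a aC) => _ ->.
Qed.

Lemma max_chain_split x z y C : z \in C -> C \in max_chains x y ->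
  (C :&: segment x z) :|: (C :&: segment z y) = C.
Proof.
move=> zC /max_chainP[sC cC _]; apply/setP=> w; rewrite !inE -andb_orr.
case wC: (w \in C) => //=; have /andP[-> ->] := sC w wC.
by rewrite andbT; apply: cC.
Qed.

Lemma max_chain_glueI x z y C D : x <= z -> z <= y ->
  C \in max_chains x z -> D \in max_chains z y ->
  [/\ (C :|: D) :&: segment x z = C, (C :|: D) :&: segment z y = D
    & C :&: D = [set z]].
Proof.
move=> xz zy mC mD; have [_ zC] := max_chain_endpoints xz mC.
have [zD _] := max_chain_endpoints zy mD.
have /max_chainP[sC _ _] := mC; have /max_chainP[sD _ _] := mD.
split; apply/setP=> w; rewrite !inE.
- apply/andP/idP => [[/orP[//|/sD/andP[zw _]] /andP[_ wz]]|wC].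
    by rewrite (@le_anti _ _ w z) ?wz.
  by rewrite wC sC.
- apply/andP/idP => [[/orP[/sC/andP[_ wz]|//] /andP[zw _]]|wD].
    by rewrite (@le_anti _ _ w z) ?wz.
  by rewrite wD orbT sD.
- apply/andP/eqP => [[/sC/andP[_ wz] /sD/andP[zw _]]|->//].
  by apply: le_anti; rewrite wz.
Qed.

(** Cutting a chain at [z] and gluing two chains at [z] are mutually inverse. *)
Lemma card_max_chains_through x z y : x <= z -> z <= y ->
  #|[set C in max_chains x y | z \in C]|
  = (#|max_chains x z| * #|max_chains z y|)%N.
Proof.
move=> xz zy; rewrite -cardsX.
rewrite -(@card_in_imset _ _ (fun p : {set P} * {set P} => p.1 :|: p.2)); last first.
  move=> [C D] [C' D'] /setXP[/= mC mD] /setXP[/= mC' mD'] /= eqU.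
  have [eC eD _] := max_chain_glueI xz zy mC mD.
  have [eC' eD' _] := max_chain_glueI xz zy mC' mD'.
  by congr (_, _); [rewrite -eC eqU | rewrite -eD eqU].
apply: eq_card => C; rewrite inE; apply/andP/imsetP => [[mC zC]|[[C1 C2]]].
  exists (C :&: segment x z, C :&: segment z y); last first.
    by rewrite /= (max_chain_split zC mC).
  by rewrite inE /= (max_chain_lower zC mC) (max_chain_upper zC mC).
move=> /setXP[/= mC mD] ->; rewrite (max_chain_glue xz zy) //.
by rewrite inE; have [_ ->] := max_chain_endpoints xz mC.
Qed.

End MaximalChains.

(** * Rank function and levels of graded intervals *)

Section Ranks.
Variables (d : Order.disp_t) (P : finTBPOrderType d).
Hypothesis gradedP : forall x y : P, (x <= y)%O -> graded_segment x y.
Implicit Types (x y z : P) (C D : {set P}).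
Local Open Scope order_scope.

Lemma card_max_chain_bot x C : C \in max_chains \bot x -> #|C| = (rho x).+1.
Proof.
move=> mC; have [C0 _] := max_chain_endpoints (le0x x) mC.
suff -> : rho x = #|C|.-1 by rewrite prednK // card_gt0; apply/set0Pn; exists \bot.
rewrite /rho /segment_length; apply/eqP; rewrite eqn_leq; apply/andP; split.
  by apply/bigmax_leqP => D mD; rewrite (gradedP (le0x x) mD mC).
exact: (@leq_bigmax_cond _ (mem (max_chains \bot x)) (fun D : {set P} => #|D|.-1)).
Qed.

(** Gluing [C] onto a maximal chain from [\bot] to [x] gives a maximal chain from [\bot] to [y]; the
    two pieces share only [x]. *)
Lemma card_max_chain x y C : x <= y -> C \in max_chains x y ->
  (rho x + #|C|)%N = (rho y).+1.
Proof.
move=> xy mC; have [D mD] := max_chain_exists \bot x.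
have [_ _ I1] := max_chain_glueI (le0x x) xy mD mC.
have := card_max_chain_bot (max_chain_glue (le0x x) xy mD mC).
by rewrite cardsU I1 cards1 (card_max_chain_bot mD) addSn subn1.
Qed.

Lemma rho_lt x y : x < y -> (rho x < rho y)%N.
Proof.
move=> xy; have [C mC] := max_chain_exists x y.
have [xC yC] := max_chain_endpoints (ltW xy) mC.
rewrite -(ltn_add2r 1) !addn1 -(card_max_chain (ltW xy) mC) -addn2 leq_add2l.
have <- : #|[set x; y]| = 2 by rewrite cards2 (lt_eqF xy).
by apply: subset_leq_card; apply/subsetP=> z /set2P[] ->.
Qed.

Lemma rho_le x y : x <= y -> (rho x <= rho y)%N.
Proof. by rewrite le_eqVlt => /orP[/eqP->//|/rho_lt/ltnW]. Qed.

Lemma rho_bot : rho (\bot : P) = 0%N.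
Proof.
have [C mC] := max_chain_exists (\bot : P) \bot.
have := card_max_chain_bot mC; suff -> : C = [set \bot] by rewrite cards1 => -[].
have [C0 _] := max_chain_endpoints (lexx _) mC.
apply/eqP; rewrite eqEsubset sub1set C0 andbT; apply/subsetP=> z.
by case/max_chainP: mC => sC _ _ /sC; rewrite lex0 inE => /andP[].
Qed.

Lemma rho_inj_le x y : x <= y -> rho x = rho y -> x = y.
Proof.
rewrite le_eqVlt => /orP[/eqP->//|/rho_lt lt_xy] exy.
by rewrite exy ltnn in lt_xy.
Qed.

(* [rho] is injective on a chain, and a maximal chain of [x, y] has as many
   elements as there are ranks between [rho x] and [rho y]. *)
Lemma max_chain_rank x y C r : x <= y -> C \in max_chains x y ->
  (rho x <= r <= rho y)%N -> #|[set z in C | rho z == r]| = 1%N.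
Proof.
move=> xy mC /andP[xr ry]; have /max_chainP[sC cC _] := mC.
have inj : {in C &, injective (@rho d P)}.
  move=> a b aC bC eab; have /orP[ab|ba] := cC a b aC bC.
    exact: rho_inj_le.
  exact/esym/rho_inj_le.
have rank_bounds z : z \in C -> (rho x <= rho z <= rho y)%N.
  by move=> /sC/andP[/rho_le-> /rho_le->].
pose h z : 'I_(rho y - rho x).+1 := inord (rho z - rho x).
have hE z : z \in C -> h z = (rho z - rho x)%N :> nat.
  move=> /rank_bounds/andP[_ zy]; rewrite inordK // ltnS.
  exact: leq_sub2r.
have h_inj : {in C &, injective h}.
  move=> a b aC bC /(congr1 val); rewrite /= !hE // => e; apply: inj => //.
  have /andP[xa _] := rank_bounds _ aC; have /andP[xb _] := rank_bounds _ bC.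
  by rewrite -(subnK xa) e subnK.
have cC1 : #|C| = (rho y - rho x).+1.
  by rewrite -subSn ?rho_le // -(card_max_chain xy mC) addKn.
have /setP/(_ (inord (r - rho x))) : h @: C = setT.
  by apply/eqP; rewrite eqEcard subsetT cardsT card_ord card_in_imset // cC1 /=.
rewrite [RHS]inE => /imsetP[z zC /(congr1 val)]; rewrite /= hE // inordK; last first.
  by rewrite ltnS leq_sub2r.
have /andP[xz _] := rank_bounds _ zC.
move=> e; have {}e : rho z = r by rewrite -(subnK xz) -e subnK.
have -> : [set w in C | rho w == r] = [set z]; last by rewrite cards1.
apply/setP=> w; rewrite !inE; apply/andP/eqP => [[wC /eqP wr]|->]; last first.
  by rewrite zC e eqxx.
by apply: inj; rewrite // wr.
Qed.

(** Ranks are counted from [x]: index 1 gives the atoms of the interval, one less than its length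
    the coatoms. *)
Definition level x y k : {set P} := [set z in segment x y | rho z == (rho x + k)%N].

Lemma levelP x y k z :
  reflect [/\ x <= z, z <= y & rho z = (rho x + k)%N] (z \in level x y k).
Proof.
rewrite !inE; apply: (iffP andP) => [[/andP[-> ->] /eqP->]|[-> -> ->]] //.
Qed.

(** Double counting of pairs of a maximal chain and a member of relative rank [k]: each chain has
    exactly one such member. *)
Lemma card_max_chains_level x y k : x <= y -> (k <= rho y - rho x)%N ->
  #|max_chains x y|
  = (\sum_(z in level x y k) #|max_chains x z| * #|max_chains z y|)%N.
Proof.
move=> xy kl.
have kl' : (rho x <= rho x + k <= rho y)%N.
  by rewrite leq_addr -(subnKC (rho_le xy)) leq_add2l.
transitivity (\sum_(C in max_chains x y) \sum_(z in level x y k | z \in C) 1)%N.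
  rewrite -sum1_card; apply: eq_bigr => C mC.
  rewrite sum1_card -(max_chain_rank xy mC kl'); apply: eq_card => z.
  rewrite [RHS]unfold_in /= !inE; case zC: (z \in C); last by rewrite andbF.
  by rewrite andbT /=; case/max_chainP: mC => /(_ z zC)->.
rewrite (exchange_big_dep (mem (level x y k))) /=; last by move=> C z _ /andP[].
apply: eq_bigr => z zl; have /levelP[xz zy _] := zl.
rewrite -card_max_chains_through // -sum1_card; apply: eq_bigl => C.
by rewrite zl [in RHS]inE.
Qed.

End Ranks.

(** * Alternating Euler sums *)

Section EulerSums.
Local Open Scope ring_scope.
Import GRing.Theory Num.Theory.

Definition euler_sum (b : nat -> rat) L : rat :=
  \sum_(k < L.+1) (-1) ^+ k / (b k * b (L - k)%N).

(* In the Euler relation of even length [L] only the two outermost terms on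
   each side involve values of [b] at [L] and [L - 1]. *)
Lemma euler_sum_compare (b c : nat -> rat) q : ~~ odd q ->
  (forall k, (k <= q.+2)%N -> b k = c k) -> b 0%N = 1 -> b 1%N = 1 ->
  euler_sum b q.+4 = 0 -> euler_sum c q.+4 = 0 ->
  (b q.+4)^-1 - (b q.+3)^-1 = (c q.+4)^-1 - (c q.+3)^-1.
Proof.
move=> evq bc b0 b1.
have c0 : c 0%N = 1 by rewrite -bc.
have c1 : c 1%N = 1 by rewrite -bc.
(* These are the terms of index 2 to [q.+2], in which no argument of [a] exceeds [q.+2]. *)
pose mid (a : nat -> rat) : rat := \sum_(k < q.+1) (-1) ^+ k.+2 / (a k.+2 * a (q.+2 - k)%N).
have split_sum (a : nat -> rat) : a 0%N = 1 -> a 1%N = 1 ->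
    euler_sum a q.+4 = 2 * (a q.+4)^-1 - 2 * (a q.+3)^-1 + mid a.
  move=> a0 a1; rewrite /euler_sum big_ord_recl big_ord_recl big_ord_recr big_ord_recr /=.
  rewrite /bump /= !add1n !subn0 !subnn a0 a1 !mul1r !mulr1 subSS subn0.
  have -> : (q.+4 - q.+3 = 1)%N by lia.
  rewrite a1 !exprS -[_ ^+ q]signr_odd (negbTE evq) /=.
  rewrite /mid; under eq_bigr => i _ do rewrite /bump /= !add1n !subSS.
  by rewrite !expr0 !mulr1; move: (\sum_(i < _) _) => s; ring.
rewrite !split_sum //.
have -> : mid b = mid c.
  by apply: eq_bigr => k _; rewrite !bc //; have := ltn_ord k; lia.
move=> e1 e2; lra.
Qed.

(** The two boundary terms add up to [1 / 2 ^ p]. The inner terms are [1 / 2 ^ p] up to alternating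
    signs; there is an odd number of them, the first negative, so they cancel the boundary. *)
Lemma euler_sum_pow2 p : ~~ odd p ->
  euler_sum (fun k => (2 ^ k.-1)%:R) p.+2 = 0.
Proof.
move=> evp; rewrite /euler_sum big_ord_recl big_ord_recr /= subnn !add0n.
have alt m : \sum_(i < m) (-1 : rat) ^+ i = (odd m)%:R.
  elim: m => [|m IH]; first by rewrite big_ord0.
  by rewrite big_ord_recr /= IH -signr_odd; case: (odd m); rewrite /= ?expr0 ?expr1; lra.
have -> : \sum_(i < p.+1) (-1) ^+ bump 0 i /
      ((2 ^ (0 + i))%:R * (2 ^ (p.+2 - bump 0 i).-1)%:R)
    = \sum_(i < p.+1) (-1) ^+ i * - ((2 ^ p)%:R)^-1 :> rat.
  apply: eq_bigr => i _; have ip := ltn_ord i; rewrite -natrM -expnD /bump !add1n.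
  have -> : (0 + i + (p.+2 - i.+1).-1 = p)%N by lia.
  by rewrite exprS mulN1r mulNr mulrN.
rewrite -mulr_suml alt /= (negbTE evp) /= !exprS -[_ ^+ p]signr_odd (negbTE evp) /= expnS natrM.
have : (2 ^ p)%:R != 0 :> rat by rewrite pnatr_eq0 -lt0n expn_gt0.
by move=> ?; field.
Qed.

(** This is the binomial expansion of [(1 - 1) ^ L] divided by the factorial of [L]. *)
Lemma euler_sum_fact L : (0 < L)%N -> euler_sum (fun k => (k`!)%:R) L = 0.
Proof.
move=> L0; have nz k : (k`!)%:R != 0 :> rat by rewrite pnatr_eq0 -lt0n fact_gt0.
have : (1 - 1 : rat) ^+ L = 0 by rewrite subrr expr0n; case: L L0.
rewrite exprBn => e; rewrite -(mul0r ((L`!)%:R^-1)) -[in RHS]e mulr_suml.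
apply: eq_bigr => k _; rewrite !expr1n !mulr1.
have kL : (k <= L)%N by rewrite -ltnS.
rewrite -(bin_fact kL) !natrM.
have : ('C(L, k))%:R != 0 :> rat by rewrite pnatr_eq0 -lt0n bin_gt0.
by move: (nz k) (nz (L - k)%N) => ? ? ?; field; apply/and3P.
Qed.

End EulerSums.

(** * Factorial and atom functions of a binomial poset *)

Section BinomialPosets.
Variables (d : Order.disp_t) (P : finTBPOrderType d).
Hypothesis binP : binomial_poset P.
Implicit Types (x y z : P).
Local Open Scope order_scope.
Notation top_rank := (poset_rank P).

Let gradedP := binP.1.

(* The paper's factorial function [B]. *)
Definition factorial_fun l : nat :=
  if [pick z : P | rho z == l] is Some z then #|max_chains \bot z| else 0%N.

Local Notation B := factorial_fun.

Lemma rank_exists r : (r <= top_rank)%N -> exists z : P, rho z = r.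
Proof.
move=> rn; have [C mC] := max_chain_exists (\bot : P) \top.
have := max_chain_rank gradedP (lex1 _) mC (r := r).
rewrite rho_bot // rn => /(_ isT)/eqP/cards1P[z /setP/(_ z)].
by rewrite !inE eqxx => /andP[_ /eqP]; exists z.
Qed.

Lemma rho_le_top x : (rho x <= top_rank)%N.
Proof. exact/(rho_le gradedP)/lex1. Qed.

Lemma card_max_chains x y : x <= y -> #|max_chains x y| = B (rho y - rho x).
Proof.
move=> xy; rewrite /factorial_fun; case: pickP => [z /eqP ez|no].
  by apply: binP.2; rewrite // rho_bot // subn0.
have [|z ez] := @rank_exists (rho y - rho x).
  exact: leq_trans (leq_subr _ _) (rho_le_top y).
by have := no z; rewrite ez eqxx.
Qed.

Lemma factorial_fun_gt0 l : (l <= top_rank)%N -> (0 < B l)%N.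
Proof.
move=> /rank_exists[z <-]; have := card_max_chains (le0x z).
rewrite rho_bot // subn0 => <-; rewrite card_gt0; apply/set0Pn.
by have [C] := max_chain_exists \bot z; exists C.
Qed.

(** By the binomial property, each element of the level lies on the same number [B k * B (L - k)] of
    maximal chains of the interval. *)
Lemma card_level x y k L : x <= y -> (rho y - rho x)%N = L -> (k <= L)%N ->
  (#|level x y k| * (B k * B (L - k)) = B L)%N.
Proof.
move=> xy <- kL; rewrite -(card_max_chains xy) (card_max_chains_level gradedP xy kL).
rewrite -sum_nat_const; apply: eq_bigr => z /levelP[xz zy ez].
by rewrite !card_max_chains // ez addKn subnDA.
Qed.

Lemma factorial_fun0 : B 0 = 1%N.
Proof.
(* In length 0 this gives [B 0 * B 0 = B 0], with [B 0] positive. *)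
have := card_level (lexx \bot) (subnn _) (leqnn _).
have -> : level (\bot : P) \bot 0 = [set \bot].
  apply/setP=> z; rewrite !inE; apply/idP/eqP => [/andP[/andP[_]]|->].
    by rewrite lex0 => /eqP.
  by rewrite lexx addn0 eqxx.
rewrite cards1 mul1n; have := @factorial_fun_gt0 0 isT; move: (B 0) => b; nia.
Qed.

Lemma factorial_fun1 : (0 < top_rank)%N -> B 1 = 1%N.
Proof.
move=> n0; have := factorial_fun_gt0 n0; have [z ez] := rank_exists n0.
have := card_max_chains (le0x z); rewrite rho_bot // subn0 ez => <- c0.
apply/eqP; rewrite eqn_leq c0 andbT -(cards1 [set \bot; z]).
apply: subset_leq_card; apply/subsetP=> C mC; rewrite inE eq_sym eqEcard.
have [C0 Cz] := max_chain_endpoints (le0x z) mC.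
rewrite (card_max_chain_bot gradedP mC) ez cards2 subUset !sub1set C0 Cz /=.
by case: eqP ez => // <-; rewrite rho_bot.
Qed.

(* The paper's atom function [A]. *)
Definition atom_fun l : nat := B l %/ B l.-1.

Local Notation A := atom_fun.

(** The division in [A] is exact: the count of the atoms exhibits [B l] as a divisor of [B l.+1]. *)
Lemma factorial_funS l : (l < top_rank)%N -> B l.+1 = (A l.+1 * B l)%N.
Proof.
move=> ln; have [z ez] := rank_exists ln.
rewrite /atom_fun /= divnK // -(card_level (le0x z) (L := l.+1) (k := 1)) //.
  by rewrite subn1 dvdn_mull // dvdn_mull.
by rewrite rho_bot // subn0.
Qed.

Lemma atom_fun_gt0 l : (l < top_rank)%N -> (0 < A l.+1)%N.
Proof.
move=> ln; have := factorial_fun_gt0 ln; rewrite factorial_funS //.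
by rewrite muln_gt0 => /andP[].
Qed.

Lemma card_atoms x y l : x <= y -> (rho y - rho x)%N = l.+1 ->
  #|level x y 1| = A l.+1.
Proof.
move=> xy e; have ln : (l < top_rank)%N.
  by rewrite -e (leq_trans (leq_subr _ _)) ?rho_le_top.
have := card_level xy e (k := 1); rewrite ltnS leq0n => /(_ isT).
rewrite [in RHS]factorial_funS // factorial_fun1 ?(leq_ltn_trans _ ln) // mul1n subn1 /=.
by move/eqP; rewrite eqn_pmul2r ?factorial_fun_gt0 ?(ltnW ln) // => /eqP.
Qed.

Lemma card_coatoms x y l : x <= y -> (rho y - rho x)%N = l.+1 ->
  #|level x y l| = A l.+1.
Proof.
move=> xy e; have ln : (l < top_rank)%N.
  by rewrite -e (leq_trans (leq_subr _ _)) ?rho_le_top.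
have := card_level xy e (k := l); rewrite leqnSn => /(_ isT).
rewrite [in RHS]factorial_funS // subSnn factorial_fun1 ?(leq_ltn_trans _ ln) // muln1.
by move/eqP; rewrite eqn_pmul2r ?factorial_fun_gt0 ?(ltnW ln) // => /eqP.
Qed.

Lemma level_exists x y k : x <= y -> (k <= rho y - rho x)%N ->
  exists z, z \in level x y k.
Proof.
move=> xy kl; apply/set0Pn; rewrite -card_gt0.
have := card_level xy erefl kl; have : (0 < B (rho y - rho x))%N.
  by apply: factorial_fun_gt0; apply: leq_trans (leq_subr _ _) (rho_le_top y).
by case: #|_| => // + e; rewrite -e.
Qed.

(** The atoms below a coatom [c] of an interval are atoms of the whole interval. *)
Lemma atom_fun_mono l : (l.+1 < top_rank)%N -> (A l.+1 <= A l.+2)%N.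
Proof.
move=> ln; have [z ez] := rank_exists ln.
have e0 : (rho z - rho (\bot : P))%N = l.+2 by rewrite rho_bot // subn0.
have [|c /levelP[_ cz ec]] := level_exists (k := l.+1) (le0x z).
  by rewrite e0.
rewrite -(card_atoms (le0x z) e0) -(card_atoms (le0x c) (l := l)); last first.
  by rewrite ec addKn.
apply: subset_leq_card; apply/subsetP=> a /levelP[a0 ac ea].
by apply/levelP; split; rewrite ?(le_trans ac).
Qed.

Lemma card_level2 x y l : x <= y -> (rho y - rho x)%N = l.+2 ->
  (#|level x y 2| * A 2 = A l.+2 * A l.+1)%N.
Proof.
move=> xy e; have ln : (l.+2 <= top_rank)%N.
  by rewrite -e (leq_trans (leq_subr _ _)) ?rho_le_top.
have := card_level xy e (k := 2) isT; rewrite !subSS subn0.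
rewrite !factorial_funS ?factorial_fun0; try lia.
have -> : A 1 = 1%N by rewrite /atom_fun factorial_fun0 factorial_fun1 //; lia.
have : (0 < B l)%N by apply: factorial_fun_gt0; lia.
by move=> B0 e2; apply/eqP; rewrite -(eqn_pmul2r B0); apply/eqP; nia.
Qed.

Lemma card_level3 x y l : x <= y -> (rho y - rho x)%N = l.+3 ->
  (#|level x y 3| * (A 3 * A 2) = A l.+3 * A l.+2 * A l.+1)%N.
Proof.
move=> xy e; have ln : (l.+3 <= top_rank)%N.
  by rewrite -e (leq_trans (leq_subr _ _)) ?rho_le_top.
have := card_level xy e (k := 3) isT; rewrite !subSS subn0.
rewrite !factorial_funS ?factorial_fun0; try lia.
have -> : A 1 = 1%N by rewrite /atom_fun factorial_fun0 factorial_fun1 //; lia.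
have : (0 < B l)%N by apply: factorial_fun_gt0; lia.
by move=> B0 e2; apply/eqP; rewrite -(eqn_pmul2r B0); apply/eqP; nia.
Qed.

Lemma factorial_fun_pow2 M : (M <= top_rank)%N ->
  (forall k, (1 < k <= M)%N -> A k = 2) ->
  forall k, (k <= M)%N -> B k = (2 ^ k.-1)%N.
Proof.
move=> Mn A2; elim=> [|[|k] IH] kM; first by rewrite factorial_fun0.
  by rewrite factorial_fun1 //; lia.
by rewrite factorial_funS ?A2 ?IH //=; try lia; rewrite expnS.
Qed.

Lemma factorial_fun_fact M : (M <= top_rank)%N ->
  (forall k, (0 < k <= M)%N -> A k = k) ->
  forall k, (k <= M)%N -> B k = k`!.
Proof.
move=> Mn Ak; elim=> [|k IH] kM; first by rewrite factorial_fun0.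
by rewrite factorial_funS ?Ak ?IH ?factS //; lia.
Qed.

(* Ranks 2 and 3 would have three elements each and form a hexagon, whereas
   the interval above an atom forces a complete bipartite graph K(2, 2). *)
Lemma no_three_atoms l : (l.+4 < top_rank)%N ->
  (forall k, (1 < k <= l.+4)%N -> A k = 2) -> A l.+4.+1 <> 3.
Proof.
move=> ln A2 A3; have [y ey] := rank_exists ln.
have r0 := rho_bot gradedP.
have ry : (rho y - rho (\bot : P))%N = l.+4.+1 by rewrite r0 ey subn0.
have [|a /levelP[_ ay ea]] := level_exists (k := 1) (le0x y); first by rewrite ry.
rewrite r0 add0n in ea.
have rya : (rho y - rho a)%N = l.+4 by rewrite ey ea subn1.
have cY : #|level a y 1| = 2 by rewrite (card_atoms ay rya) A2 //; lia.
have cZ : #|level a y 2| = 2.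
  by have := card_level2 ay rya; rewrite !A2; lia.
have c2 : #|level \bot y 2| = 3.
  by have := card_level2 (le0x y) ry; rewrite A3 !A2; lia.
have c3 : #|level \bot y 3| = 3.
  by have := card_level3 (le0x y) ry; rewrite A3 !A2; lia.
have card_up z : z \in level \bot y 2 -> #|level z y 1| = 2.
  move=> /levelP[_ zy ez]; rewrite (card_atoms zy (l := l.+2)) ?A2 //; lia.
have YY : level a y 1 \subset level \bot y 2.
  apply/subsetP=> z /levelP[_ zy ez]; apply/levelP; split; rewrite ?le0x //; lia.
have ZZ : level a y 2 \subset level \bot y 3.
  apply/subsetP=> z /levelP[_ zy ez]; apply/levelP; split; rewrite ?le0x //; lia.
have upY z : z \in level a y 1 -> level z y 1 = level a y 2.
  move=> zY; apply/eqP; rewrite eqEcard cZ card_up ?(subsetP YY) //= andbT.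
  have /levelP[az _ ez] := zY.
  apply/subsetP=> w /levelP[zw wy ew]; apply/levelP.
  by split; rewrite ?(le_trans az zw) //; lia.
(* [z] has rank 3, so the interval below it has only [A 3 = 2] coatoms, and [upY] puts both elements
   of [level a y 1] among them. *)
have downZ z : z \in level a y 2 -> level \bot z 2 = level a y 1.
  move=> zZ; apply/esym/eqP; have /levelP[az zy ez] := zZ.
  rewrite eqEcard cY (card_coatoms (le0x z) (l := 2)) ?A2 //= ?andbT; try lia.
  apply/subsetP=> w wY; have /levelP[aw wy ew] := wY.
  move: zZ; rewrite -(upY w wY) => /levelP[wz _ _].
  by apply/levelP; split; rewrite ?le0x //; lia.
(* The third element [t] of rank 2 has two covers below [y]. By [downZ] neither is in [level a y 2],
   which leaves just one element of rank 3. *)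
have [t] : exists t, t \in level \bot y 2 :\: level a y 1.
  by apply/set0Pn; rewrite -card_gt0 cardsDS // c2 cY.
rewrite inE => /andP[tY t2]; have ct := card_up t t2.
have /levelP[_ ty et] := t2.
have : level t y 1 \subset level \bot y 3 :\: level a y 2.
  apply/subsetP=> z /levelP[tz zy ez]; rewrite inE; apply/andP; split.
    apply: contra tY => zZ; rewrite -(downZ z zZ).
    by apply/levelP; split; rewrite ?le0x //; lia.
  by apply/levelP; split; rewrite ?le0x //; lia.
by move/subset_leq_card; rewrite ct cardsDS // c3 cZ.
Qed.

End BinomialPosets.

(** * Values of the atom function under the Euler relation *)

Section EulerianBinomialPosets.
Variables (d : Order.disp_t) (P : finTBPOrderType d).
Hypotheses (binP : binomial_poset P) (eulP : eulerian P).
Implicit Types (x y z : P).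
Import GRing.Theory Num.Theory.
Local Notation B := (factorial_fun P).
Local Notation A := (atom_fun P).
Local Notation top_rank := (poset_rank P).
Let gradedP := binP.1.

(** The signs [(-1) ^ rho z] cancel over the interval from [\bot] to an element of rank [L];
    grouping by rank and dividing by [B L] gives the sum. *)
Lemma euler_relation L : 0 < L <= top_rank ->
  (euler_sum (fun k => (B k)%:R) L = 0)%R.
Proof.
case/andP=> L0 Ln; have [y ey] := rank_exists binP Ln.
have y0 : (\bot < y)%O.
  by rewrite lt0x; apply: contraTneq L0 => y0; rewrite -ey y0 rho_bot.
have alt : (\sum_(z in segment \bot%O y) (-1 : rat) ^+ rho z = 0)%R.
  rewrite (bigID (fun z => odd (rho z))) /=.
  under eq_bigr => z /andP[_ oz] do rewrite -signr_odd oz.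
  rewrite [X in (_ + X)%R](eq_bigr (fun=> 1%R)); last first.
    by move=> z /andP[_ oz]; rewrite -signr_odd (negbTE oz).
  have card_sum (p : pred P) (c : rat) :
      (\sum_(z in segment \bot%O y | p z) c = c *+ #|[set z in segment \bot%O y | p z]|)%R.
    by rewrite -sumr_const; apply: eq_bigl => z; rewrite [in RHS]inE.
  by rewrite !card_sum (eulP.2 _ _ y0) expr1 mulNrn addNr.
have BL : ((B L)%:R != 0 :> rat)%R.
  by rewrite pnatr_eq0 -lt0n factorial_fun_gt0.
apply: (mulfI BL); rewrite mulr0 -[RHS]alt mulr_sumr.
rewrite (partition_big (fun z => inord (rho z) : 'I_L.+1) predT) //=.
apply: eq_bigr => k _; have kL : k <= L by rewrite -ltnS.
have <- : (\sum_(z in level \bot%O y k) (-1 : rat) ^+ k =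
  \sum_(z in segment \bot%O y | inord (rho z) == k) (-1) ^+ rho z)%R.
  apply/esym/eq_big => [z|z /andP[zy /eqP <-]].
    rewrite [in RHS]inE rho_bot // add0n.
    case zy: (z \in segment \bot%O y) => //=.
    have rz : rho z < L.+1.
      by rewrite ltnS -ey rho_le //; move: zy; rewrite inE => /andP[].
    by rewrite -val_eqE /= inordK.
  by rewrite inordK // ltnS -ey rho_le //; move: zy; rewrite inE => /andP[].
have := @card_level _ _ binP \bot%O y k L (le0x y).
rewrite rho_bot // subn0 => /(_ ey kL) <-.
rewrite sumr_const -[in RHS]mulr_natl !natrM.
have Bk : ((B k)%:R != 0 :> rat)%R.
  by rewrite pnatr_eq0 -lt0n factorial_fun_gt0 //; apply: leq_trans Ln.
have BLk : ((B (L - k)%N)%:R != 0 :> rat)%R.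
  rewrite pnatr_eq0 -lt0n factorial_fun_gt0 //.
  exact: leq_trans (leq_subr _ _) Ln.
by field; apply/andP.
Qed.

(* Written without subtraction; over the rationals it reads
   1/(A(q+4) A(q+3)) - 1/A(q+3) = 1/(s t) - 1/s. *)
Lemma atom_fun_euler (c : nat -> nat) q s t : ~~ odd q -> q.+4 <= top_rank ->
  (forall k, k <= q.+2 -> B k = c k) ->
  c q.+3 = s * c q.+2 -> c q.+4 = t * c q.+3 -> 0 < s -> 0 < t ->
  (euler_sum (fun k => (c k)%:R) q.+4 = 0)%R ->
  A q.+4 * (t * s) + A q.+4 * A q.+3 = t * s + t * (A q.+4 * A q.+3).
Proof.
move=> evq qn Bc cs ct s0 t0 ec.
have n0 : 0 < top_rank by lia.
have := @euler_sum_compare (fun k => (B k)%:R%R) (fun k => (c k)%:R%R) q evq.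
rewrite factorial_fun0 // factorial_fun1 // ec euler_relation ?qn //.
move=> /(_ _ erefl erefl erefl erefl) e.
have {}e := e (fun k kq => congr1 _ (Bc k kq)).
have q3 : q.+2 < top_rank by lia.
move: e; rewrite (factorial_funS binP qn) (factorial_funS binP q3) Bc // ct cs.
have c0 : 0 < c q.+2 by rewrite -Bc // factorial_fun_gt0 //; lia.
have A3 : 0 < A q.+3 by apply: atom_fun_gt0 => //; lia.
have A4 : 0 < A q.+4 by apply: atom_fun_gt0 => //; lia.
move: (A q.+4) (A q.+3) (c q.+2) A4 A3 c0 => b a g b0 a0 g0; rewrite !natrM => e.
have nz k : 0 < k -> (k%:R != 0 :> rat)%R by rewrite pnatr_eq0 -lt0n.
move/nz: b0 => b0; move/nz: a0 => a0; move/nz: g0 => g0.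
move/nz: s0 => s0; move/nz: t0 => t0.
apply/eqP; rewrite -(eqr_nat rat) !(natrD, natrM); apply/eqP.
(* The common factor [1 / c q.+2] cancels; the remaining denominators are cleared next. *)
have {}e : ((b%:R * a%:R)^-1 - (a%:R)^-1 = (t%:R * s%:R)^-1 - (s%:R)^-1 :> rat)%R.
  apply: (mulIf (invr_neq0 g0)); move: e.
  by rewrite !mulrBl -!invfM !mulrA.
have {}e : ((t%:R * s%:R) * (b%:R * a%:R) * ((b%:R * a%:R)^-1 - (a%:R)^-1)
  = (t%:R * s%:R) * (b%:R * a%:R) * ((t%:R * s%:R)^-1 - (s%:R)^-1) :> rat)%R.
  by rewrite e.
have e1 : ((t%:R * s%:R) * (b%:R * a%:R) * ((b%:R * a%:R)^-1 - (a%:R)^-1)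
  = t%:R * s%:R - b%:R * (t%:R * s%:R) :> rat)%R by field; apply/andP.
have e2 : ((t%:R * s%:R) * (b%:R * a%:R) * ((t%:R * s%:R)^-1 - (s%:R)^-1)
  = b%:R * a%:R - t%:R * (b%:R * a%:R) :> rat)%R by field; apply/andP.
move: e; rewrite e1 e2 => e; lra.
Qed.

(** In length 2 the Euler relation reads [2 / A 2 - 1 = 0]. *)
Lemma atom_fun2 : 1 < top_rank -> A 2 = 2.
Proof.
move=> n2; have n0 : 0 < top_rank by lia.
have := @euler_relation 2; rewrite n2 => /(_ isT).
rewrite /euler_sum !big_ord_recl big_ord0 /= /bump /= !addn0 add1n.
rewrite subn0 subnn subSS subn0 (factorial_funS binP n2).
rewrite factorial_fun0 // factorial_fun1 // muln1 expr0 expr1 expr2.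
have : ((A 2)%:R != 0 :> rat)%R by rewrite pnatr_eq0 -lt0n atom_fun_gt0.
move=> a0 e; apply/eqP; rewrite -(eqr_nat rat); apply/eqP.
apply: (mulIf (invr_neq0 a0)); rewrite divff //; move: e.
rewrite !mulr1 !mul1r; move: (_^-1)%R => r; lra.
Qed.

Lemma atom_fun_dichotomy j : 2 <= j -> j.*2 <= top_rank ->
  (forall k, 1 < k <= j.*2 -> A k = 2) \/ (forall k, 0 < k <= j.*2 -> A k = k).
Proof.
(* With [s = t = 2] the relation becomes [A q.+4 * (4 - A q.+3) = 4]; the value [A q.+3 = 1] would
   require [3 * A q.+4 = 4]. *)
have step_pow2 q : ~~ odd q -> q.+4 <= top_rank ->
    (forall k, 1 < k <= q.+2 -> A k = 2) ->
    A q.+3 = 2 /\ A q.+4 = 2 \/ A q.+3 = 3 /\ A q.+4 = 4.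
  move=> evq qn A2.
  have := @atom_fun_euler (fun k => 2 ^ k.-1) q 2 2 evq qn.
  have q2n : q.+2 <= top_rank by lia.
  rewrite euler_sum_pow2 /= ?evq //.
  move=> /(_ (factorial_fun_pow2 binP q2n A2) (expnS _ _) (expnS _ _) isT isT erefl).
  have := atom_fun_gt0 binP (l := q.+2); have := atom_fun_gt0 binP (l := q.+3).
  rewrite qn (ltnW qn) => /(_ isT) b0 /(_ isT) a0 e.
  have : A q.+3 < 4 by nia.
  move: (A q.+3) a0 e => [|[|[|[|]]]] //; lia.
(* Length 4 is the base case: [A 2 = 2] fits both patterns, so both outcomes of [step_pow2]
   survive. *)
elim: j => // j IH j2 jn; have [->|j3] := eqVneq j 1.
- have A2 : A 2 = 2 by apply: atom_fun2; lia.
  have A1 : A 1 = 1.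
    by rewrite /atom_fun factorial_fun0 // factorial_fun1 //; lia.
  have [|k|[A3 A4]|[A3 A4]] := step_pow2 0 isT; first by lia.
  + by move=> k2; have -> : k = 2 by lia.
  + by left=> -[|[|[|[|[|k]]]]].
  + by right=> -[|[|[|[|[|k]]]]].
case: j j2 j3 IH jn => [|[|i]] // _ _ IH.
rewrite doubleS; set q := i.+1.*2 => qn; have evq : ~~ odd q by rewrite odd_double.
have q2 : i.+2.*2 = q.+2 by rewrite doubleS.
have q2n : q.+2 <= top_rank by lia.
have [//||A2|Ak] := IH; rewrite ?q2 //.
- left=> k kq; have [|[A3 A4]|[A3 _]] := step_pow2 q evq qn; first by rewrite -q2.
    have [k3|k3] := leqP k q.+2; first by apply: A2; lia.
    by have [->|->] : k = q.+3 \/ k = q.+4 by lia.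
  (* The argument [i.*2] makes [l.+4] equal to [q.+2], the last index known to have value 2. *)
  by case: (@no_three_atoms _ _ binP i.*2); rewrite -?doubleS //; lia.
- right=> k kq.
  have := @atom_fun_euler (fun k => k`!) q q.+3 q.+4 evq qn.
  rewrite euler_sum_fact // -q2.
  move=> /(_ (factorial_fun_fact binP _ Ak) (factS _) (factS _) isT isT erefl).
  rewrite {1}q2 => /(_ q2n).
  have := atom_fun_mono binP (l := q.+2); have := atom_fun_mono binP (l := q.+1).
  rewrite qn (ltnW qn) (Ak q.+2) ?q2 ?leqnn // => /(_ isT) a0 /(_ isT) b0 e.
  have q0 : 1 < q by rewrite /q; lia.
  (* The factor [q.+3] has been cancelled; what remains is [A q.+4 * (q.+4 - A q.+3) = q.+4]. *)
  have {}e : q.+4 * A q.+4 = A q.+4 * A q.+3 + q.+4 by nia.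
  have {}e : A q.+3 = q.+3 /\ A q.+4 = q.+4.
    have a4 : A q.+3 < q.+4 by nia.
    (* The lower bound is monotonicity. The first value would give [2 * A q.+4 = q.+4], against
       [A q.+4 >= q.+2] and [q > 1]. *)
    have [a2|a3] : A q.+3 = q.+2 \/ A q.+3 = q.+3 by lia.
      by rewrite a2 in e; nia.
    by split=> //; rewrite a3 in e; nia.
  have [k3|k3] := leqP k q.+2; first by apply: Ak; lia.
  by case: e => ? ?; have [->|->] : k = q.+3 \/ k = q.+4 by lia.
Qed.

End EulerianBinomialPosets.

Lemma poset_isomorphic_inv (d d' : Order.disp_t) (P : porderType d)
    (Q : porderType d') (g : Q -> P) :
  bijective g -> {mono g : x y / (x <= y)%O} -> poset_isomorphic P Q.
Proof.
case=> f gK fK g_mono; exists f; first by exists g.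
by move=> x y; rewrite -[in RHS](fK x) -[in RHS](fK y) g_mono.
Qed.

(** * The butterfly case *)

Section ButterflyCase.
Variables (d : Order.disp_t) (P : finTBPOrderType d) (n : nat).
Hypotheses (binP : binomial_poset P) (rankP : poset_rank P = n) (n_gt1 : 1 < n).
Hypothesis atoms2 : forall k, 1 < k <= n -> atom_fun P k = 2.
Implicit Types x y z : P.
Let gradedP := binP.1.

(** In length [L] the powers of 2 leave the exponent [(L - 1) - (k - 1) - (L - k - 1) = 1]. *)
Lemma card_level_pow2 x y k : (x <= y)%O -> 0 < k < rho y - rho x ->
  #|level x y k| = 2.
Proof.
move=> xy /andP[k0 kl]; have := card_level binP xy erefl (ltnW kl).
have yn : rho y <= n by rewrite -rankP rho_le_top.
rewrite !(factorial_fun_pow2 binP (M := n)) ?rankP //; try lia.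
rewrite -expnD => e; apply/eqP.
rewrite -(eqn_pmul2r (m := 2 ^ (k.-1 + (rho y - rho x - k).-1))) ?expn_gt0 //.
by rewrite e -expnS; apply/eqP; congr (2 ^ _); lia.
Qed.

Lemma rho_eq0 x : rho x = 0 -> x = \bot%O.
Proof. by move=> x0; apply/esym/(rho_inj_le gradedP); rewrite ?le0x // x0 rho_bot. Qed.

Lemma rho_eq_top x : rho x = n -> x = \top%O.
Proof. by rewrite -rankP; apply: (rho_inj_le gradedP (lex1 x)). Qed.

(** At an inner rank, both the interval above [x] and the whole poset have two elements, so all
    elements of that rank lie above [x]. *)
Lemma rho_lt_le x y : rho x < rho y -> (x <= y)%O.
Proof.
move=> xy; have yn : rho y <= n by rewrite -rankP rho_le_top.
have [/rho_eq0->|x0] := eqVneq (rho x) 0; first exact: le0x.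
have [/rho_eq_top->|y1] := eqVneq (rho y) n; first exact: lex1.
have rT : rho (\top%O : P) = n := rankP.
have r0 : rho (\bot%O : P) = 0 := rho_bot gradedP.
suff /setP/(_ y) : level x \top%O (rho y - rho x) = level \bot%O \top%O (rho y).
  rewrite [RHS]inE inE /= r0 add0n eqxx andbT [y \in segment \bot%O _]inE le0x lex1.
  by rewrite inE => /andP[/andP[]].
apply/eqP; rewrite eqEcard !card_level_pow2 ?lex1 ?rT ?r0 //=; try lia.
rewrite andbT; apply/subsetP=> z /levelP[_ _ ez]; apply/levelP.
by split; rewrite ?le0x ?lex1 //; lia.
Qed.

(** Any enumeration of a rank will do, since comparability depends only on ranks. The default of
    [nth] is never reached: inner ranks have two elements. *)
Definition of_butterfly (b : butterfly n) : P :=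
  match b with
  | BBot => \bot%O
  | BMid k i => nth \bot%O (enum (level (\bot%O : P) \top%O k.+1)) i
  | BTop => \top%O
  end.

Lemma card_inner_level (k : 'I_n.-1) : #|level (\bot%O : P) \top%O k.+1| = 2.
Proof.
rewrite card_level_pow2 ?le0x // rho_bot // subn0.
by have -> : rho (\top%O : P) = n := rankP; have := ltn_ord k; lia.
Qed.

Lemma rho_of_butterfly b : rho (of_butterfly b) = butterfly_level b.
Proof.
case: b => [|k i|] /=; first exact: rho_bot; last first.
  by rewrite prednK ?(ltnW n_gt1) // -rankP.
have : nth \bot%O (enum (level (\bot%O : P) \top%O k.+1)) i
    \in enum (level (\bot%O : P) \top%O k.+1).
  by rewrite mem_nth // -cardE card_inner_level ltn_ord.
by rewrite mem_enum => /levelP[_ _ ->]; rewrite rho_bot.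
Qed.

Lemma of_butterfly_inj : injective of_butterfly.
Proof.
move=> b b' e; have := congr1 (@rho _ _) e; rewrite !rho_of_butterfly.
case: b b' e => [|k i|] [|l j|] //= e kl; last first.
- by have := ltn_ord l; lia.
- by have := ltn_ord k; lia.
have {}kl : k = l by apply: val_inj; case: kl.
rewrite -{l}kl in e *; congr (BMid _ _); apply: val_inj.
move/eqP: e; rewrite nth_uniq ?enum_uniq //; first by move/eqP.
  by rewrite -cardE card_inner_level ltn_ord.
by rewrite -cardE card_inner_level ltn_ord.
Qed.

Lemma of_butterfly_surj x : exists b, of_butterfly b = x.
Proof.
have [/rho_eq0->|x0] := eqVneq (rho x) 0; first by exists BBot.
have [/rho_eq_top->|x1] := eqVneq (rho x) n; first by exists BTop.
have xn : rho x <= n by rewrite -rankP rho_le_top.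
have kn : (rho x).-1 < n.-1 by lia.
pose k := Ordinal kn.
have xl : x \in enum (level (\bot%O : P) \top%O k.+1).
  rewrite mem_enum; apply/levelP; split; rewrite ?le0x ?lex1 // rho_bot //=; lia.
have ix : index x (enum (level (\bot%O : P) \top%O k.+1)) < 2.
  by rewrite -(card_inner_level k) cardE index_mem.
by exists (BMid k (Ordinal ix)); rewrite /= nth_index.
Qed.

(** In both posets the order is equality or strictly smaller rank, and [of_butterfly] preserves
    rank. *)
Lemma butterfly_isomorphic : poset_isomorphic P (butterfly n).
Proof.
apply: (@poset_isomorphic_inv _ _ _ _ of_butterfly).
  apply: inj_card_bij of_butterfly_inj _.
  rewrite -(size_codom of_butterfly) cardE; apply: uniq_leq_size (enum_uniq _) _.
  by move=> x _; have [b <-] := of_butterfly_surj x; apply: codom_f.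
move=> b b'; rewrite [RHS]butterfly_leE -!rho_of_butterfly.
apply/idP/orP => [|[/eqP->//|/rho_lt_le//]].
rewrite le_eqVlt => /orP[/eqP/of_butterfly_inj->|/(rho_lt gradedP)]; last by right.
by left.
Qed.

End ButterflyCase.

(** * The boolean case *)

Section BooleanCase.
Variables (d : Order.disp_t) (P : finTBPOrderType d) (n : nat).
Hypotheses (binP : binomial_poset P) (rankP : poset_rank P = n).
Hypothesis atomsE : forall k, 0 < k <= n -> atom_fun P k = k.
Implicit Types a b c e u v w x y z : P.
Let gradedP := binP.1.
Local Open Scope order_scope.

Lemma card_atoms_boolean x y : x <= y -> #|level x y 1| = (rho y - rho x)%N.
Proof.
move=> xy; have yn : (rho y <= n)%N by rewrite -rankP rho_le_top.
case e: (rho y - rho x)%N => [|l]; last first.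
  by rewrite (card_atoms binP xy e) atomsE //; lia.
apply/eqP; rewrite cards_eq0; apply/eqP/setP=> z; rewrite [RHS]inE.
by apply/negP=> /levelP[_ /(rho_le gradedP) zy ez]; lia.
Qed.

Lemma card_coatoms_boolean x y l : x <= y -> (rho y - rho x)%N = l.+1 ->
  #|level x y l| = l.+1.
Proof.
move=> xy e; have yn : (rho y <= n)%N by rewrite -rankP rho_le_top.
by rewrite (card_coatoms binP xy e) atomsE //; lia.
Qed.

Lemma atoms_rank2 x c a b e : c \in level x \top 2 ->
  a \in level x c 1 -> b \in level x c 1 -> a != b ->
  e \in level x c 1 -> e = a \/ e = b.
Proof.
move=> /levelP[xc _ rc] ac bc ab ec.
suff /setP/(_ e) : [set a; b] = level x c 1 by rewrite ec => /set2P.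
apply/eqP; rewrite eqEcard card_atoms_boolean // rc addKn cards2 ab /= andbT.
by apply/subsetP=> w /set2P[] ->.
Qed.

(* If [c <> c'], no coatom of [x, z] lies above both by induction, so
   [2 (L - 2) <= L - 1] by counting the coatoms above [a]: hence [L = 3], where
   the third cover of [x] would need two coatoms other than [c] and [c']. *)
Lemma join_unique x z a b c c' : x <= z -> a != b ->
  a \in level x c 1 -> b \in level x c 1 ->
  a \in level x c' 1 -> b \in level x c' 1 ->
  c \in level x z 2 -> c' \in level x z 2 -> c = c'.
Proof.
move=> xz ab; have [L] := ubnP (rho z - rho x); elim: L z xz => // L IH z xz zL.
move=> ac bc ac' bc' cz cz'; apply/eqP/negP => /negP cc.
have /levelP[xc cz1 rc] := cz; have /levelP[xc' cz1' rc'] := cz'.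
have ncz : c != z.
  apply: contra cc => /eqP ez; rewrite eq_sym; apply/eqP.
  by apply: (rho_inj_le gradedP); rewrite ?ez // -ez rc rc'.
have rcz : (rho c < rho z)%N by apply: (rho_lt gradedP); rewrite lt_neqAle ncz.
have [l e] : exists l, (rho z - rho x)%N = l.+3.
  by exists (rho z - rho x - 3)%N; move: rc rcz; clear; lia.
have /levelP[xa ac1 ra] := ac; have /levelP[_ ac1' _] := ac'.
have za : a <= z := le_trans ac1 cz1.
pose D := level c z l; pose D' := level c' z l.
have cD : (#|D| = l.+1)%N.
  by apply: card_coatoms_boolean => //; move: rc e; clear; lia.
have cD' : (#|D'| = l.+1)%N.
  by apply: card_coatoms_boolean => //; move: rc' e; clear; lia.
have dis : [disjoint D & D'].
  rewrite -setI_eq0; apply/eqP/setP=> w; rewrite !inE.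
  apply/negP=> /andP[/andP[/andP[cw wz] /eqP rw] /andP[/andP[cw' _] _]].
  move/negP: cc; apply; apply/eqP; apply: (IH w) => //.
  - exact: le_trans xc cw.
  - by move: rw rc e zL; clear; lia.
  - by apply/levelP.
  - by apply/levelP.
have sub : D :|: D' \subset level a z l.+1.
  apply/subsetP=> w /setUP[] /levelP[cw wz rw]; apply/levelP.
    by split; [exact: le_trans cw | | move: rw ra rc; clear; lia].
  by split; [exact: le_trans cw | | move: rw ra rc'; clear; lia].
have := subset_leq_card sub; rewrite cardsU.
move: dis; rewrite -setI_eq0 => /eqP ->; rewrite cards0 subn0 cD cD'.
rewrite (card_coatoms_boolean za (l := l.+1)) => [l0|]; last by move: ra e; clear; lia.
have {}l0 : l = 0%N by move: l0; clear; lia.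
subst l.
have [f fP] : exists f, f \in level x z 1 :\: [set a; b].
  apply/set0Pn; rewrite -card_gt0 cardsDS ?card_atoms_boolean // ?e ?cards2 ?ab //.
  have /levelP[xb bc1 rb] := bc.
  apply/subsetP=> w /set2P[] ->; apply/levelP; split=> //.
  exact: le_trans bc1 cz1.
case/setDP: fP => /levelP[xf fz rf]; rewrite !inE negb_or => /andP[fa fb].
have nfc w : w \in level x z 2 -> a \in level x w 1 -> b \in level x w 1 ->
    ~~ (f <= w).
  move=> /levelP[xw wz rw] aw bw; apply/negP=> fw.
  have [] := @atoms_rank2 x w a b f _ aw bw ab.
  - by apply/levelP; rewrite lex1.
  - by apply/levelP.
  - by move/eqP; apply/negP.
  - by move/eqP; apply/negP.
have : [set c; c'] :|: level f z 1 \subset level x z 2.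
  apply/subsetP=> w /setUP[/set2P[] -> //|/levelP[fw wz rw]].
  by apply/levelP; split; [exact: le_trans fw | | move: rf rw; clear; lia].
move/subset_leq_card; rewrite (card_coatoms_boolean xz e) cardsU cards2 cc.
have -> : [set c; c'] :&: level f z 1 = set0.
  apply/setP=> w; rewrite [RHS]inE; apply/negP=> /setIP[/set2P[] ->].
    by case/levelP => fc _ _; have := nfc c cz ac bc; rewrite fc.
  by case/levelP => fc _ _; have := nfc c' cz' ac' bc'; rewrite fc.
by rewrite cards0 card_atoms_boolean //; move: rf e; clear; lia.
Qed.

(** Each cover of [a] below [v] has one further atom over [x]. This assignment is injective by
    [join_unique], and [a] has as many covers below [v] as [x] has atoms other than [a], so [b] is
    reached. *)
Lemma join_exists x v a b : x <= v -> a != b ->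
  a \in level x v 1 -> b \in level x v 1 ->
  exists c, [/\ c \in level x v 2, a <= c & b <= c].
Proof.
move=> xv ab av bv; have /levelP[xa av1 ra] := av.
(* The default [a] is never taken when [c] is in [level a v 1]. *)
pose h c := odflt a [pick e in level x c 1 :\ a].
have hP c : c \in level a v 1 ->
    [/\ c \in level x v 2, a <= c, h c \in level x c 1 & h c != a].
  case/levelP=> ac cv rc; have xc := le_trans xa ac.
  have rc2 : rho c = (rho x + 2)%N by move: rc ra; clear; lia.
  rewrite /h; case: pickP => [e /setD1P[ea ec]|no] /=.
    by split=> //; apply/levelP.
  have : #|level x c 1 :\ a| = 0%N by apply: eq_card0.
  have := cardsD1 a (level x c 1); rewrite card_atoms_boolean // rc2.
  have -> : a \in level x c 1 by apply/levelP.
  by move=> e1 e2; move: e1; rewrite e2; clear; lia.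
have h_inj : {in level a v 1 &, injective h}.
  move=> c c' /hP[cv ac hc hca] /hP[cv' ac' hc' _] e.
  have /levelP[_ _ rh] := hc.
  apply: (join_unique xv hca) => //; try (by apply/levelP); by rewrite e.
have sub : h @: level a v 1 \subset level x v 1 :\ a.
  apply/subsetP=> _ /imsetP[c /hP[/levelP[_ cv _] _ hc hca] ->].
  apply/setD1P; split=> //; have /levelP[xh hc1 rh] := hc.
  by apply/levelP; split=> //; apply: le_trans cv.
have /setP/(_ b) : h @: level a v 1 = level x v 1 :\ a.
  apply/eqP; rewrite eqEcard sub card_in_imset // card_atoms_boolean //=.
  have := cardsD1 a (level x v 1); rewrite card_atoms_boolean // av.
  by move=> e; rewrite -(leq_add2l true) -e; move: ra; clear; lia.
rewrite [RHS]inE bv inE eq_sym ab => /imsetP[c /hP[cv ac /levelP[_ hc _] _] ->].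
by exists c.
Qed.

(** Induction on the length, replacing the base [x] by an atom [a]. A cover [c] of [a] below [u] has
    a second atom [b] over [x]; the join of [a] and [b] inside [v] must be [c], so [c] lies below
    [v]. *)
Lemma atoms_below_le x u v : x <= u -> x <= v ->
  (forall a, a \in level x u 1 -> a <= v) -> u <= v.
Proof.
have [m] := ubnP (rho u - rho x); elim: m x => // m IH x um xu xv sub.
have [->//|xneu] := eqVneq u x.
have rxu : (rho x < rho u)%N by apply: (rho_lt gradedP); rewrite lt_neqAle eq_sym xneu.
have [|a au] := level_exists binP (k := 1) xu; first by move: rxu; clear; lia.
have av := sub a au; have /levelP[xa au1 ra] := au.
apply: (IH a) => // [|c /levelP[ac cu rc]]; first by move: um ra rxu; clear; lia.
have xc := le_trans xa ac.
have rc2 : rho c = (rho x + 2)%N by move: rc ra; clear; lia.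
have aic : a \in level x c 1 by apply/levelP.
have [b /setD1P[ba bc]] : exists b, b \in level x c 1 :\ a.
  apply/set0Pn; rewrite -card_gt0.
  have := cardsD1 a (level x c 1); rewrite card_atoms_boolean // rc2 aic.
  by clear; lia.
have /levelP[xb bc1 rb] := bc.
have bv : b <= v by apply: sub; apply/levelP; split=> //; apply: le_trans cu.
have [||c' [/levelP[xc' c'v rc'] bc' ac']] := @join_exists x v b a xv ba;
  try by apply/levelP.
suff -> : c = c' by [].
(* Uniqueness is taken up to [\top], since [c] is known below [u] and [c'] below [v]. *)
by apply: (@join_unique x \top b a c c') => //; try (by apply/levelP);
  rewrite ?lex1 //; apply/levelP; rewrite lex1.
Qed.

(** The sizes of the ranks are the binomial coefficients, which add up to [(1 + 1) ^ n]. *)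
Lemma card_boolean : #|P| = (2 ^ n)%N.
Proof.
have r0 : rho (\bot : P) = 0%N := rho_bot gradedP.
have rT : rho (\top : P) = n := rankP.
rewrite -sum1_card (partition_big (fun z : P => inord (rho z) : 'I_n.+1) predT) //=.
rewrite -[2]/(1 + 1)%N expnDn; apply: eq_bigr => k _.
have kn : (k <= n)%N by rewrite -ltnS.
rewrite !exp1n !muln1.
transitivity #|level (\bot : P) \top k|.
  rewrite -sum1_card; apply: eq_bigl => z.
  rewrite !inE le0x lex1 r0 add0n -val_eqE /= inordK // ltnS -rankP.
  exact: rho_le_top.
have := card_level binP (le0x \top) (L := n) (k := k); rewrite r0 rT subn0 kn.
move=> /(_ erefl isT).
rewrite !(factorial_fun_fact binP (M := n)) ?rankP ?leq_subr // -(bin_fact kn).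
by move/eqP; rewrite eqn_pmul2r ?muln_gt0 ?fact_gt0 // => /eqP.
Qed.

Lemma boolean_isomorphic : poset_isomorphic P (boolean_lattice n).
Proof.
pose at_ := enum (level (\bot : P) \top 1).
have size_at : size at_ = n.
  by rewrite -cardE card_atoms_boolean // rho_bot // subn0; apply: rankP.
pose f x : boolean_lattice n := [set i : 'I_n | nth \bot at_ i <= x].
have f_mono : {mono f : x y / x <= y}.
  move=> x y; rewrite boolean_lattice_leE; apply/subsetP/idP => [sxy|xy i]; last first.
    by rewrite !inE => /le_trans; apply.
  apply: (atoms_below_le (le0x x) (le0x y)) => a /levelP[_ ax ra].
  have a_at : a \in at_ by rewrite mem_enum; apply/levelP; rewrite le0x lex1.
  have ia : (index a at_ < n)%N by rewrite -size_at index_mem.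
  by have := sxy (Ordinal ia); rewrite !inE /= nth_index //; apply.
have f_inj : injective f.
  by move=> x y e; apply/le_anti; rewrite -!f_mono e lexx.
exists f => //.
(* Surjectivity comes from counting, so no joins of arbitrary sets of atoms are constructed. *)
have := @inj_card_bij P {set 'I_n} f f_inj; apply.
by rewrite card_boolean -cardsT -powersetT card_powerset cardsT card_ord.
Qed.

End BooleanCase.

Theorem theorem3p11 (d : Order.disp_t) (P : finTBPOrderType d) (n m : nat)
    (n_even : n = 2 * m) (n_ge4 : 4 <= n)
    (P_eulerian : eulerian P) (P_binomial : binomial_poset P)
    (P_rank : poset_rank P = n) :
  poset_isomorphic P (butterfly n) \/ poset_isomorphic P (boolean_lattice n).
Proof.
have n2 : m.*2 = n by rewrite -mul2n.
have [||A2|Ak] := @atom_fun_dichotomy _ _ P_binomial P_eulerian m.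
- by move: n_ge4; rewrite n_even; clear; lia.
- by rewrite n2 P_rank.
- left; apply: (butterfly_isomorphic P_binomial P_rank); last by rewrite -n2.
  exact: leq_trans n_ge4.
- by right; apply: (boolean_isomorphic P_binomial P_rank); rewrite -n2.
Qed.
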